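(* Let $H$ be an infinite-dimensional separable real Hilbert space. Then there exists a continuous quadratic convex function $F:H\to\mathbb{R}$ with $F(u)=0$ if and only if $u=0$, such that the following is true: for any monotone decreasing integrable function $g:[0,\infty)\to\mathbb{R}$, there exists a gradient flow solution $u:[0,\infty)\to H$ of $F$ such that \[ F(u(t))\ge g(t)\qquad\text{for all } t\ge 1. \]
   Context: A gradient flow solution of a continuously Fréchet differentiable function $F:H\to\mathbb{R}$ is a differentiable curve $u:[0,\infty)\to H$ with $\dot u(t)=-\nabla F(u(t))$ for all $t\ge0$, where $\nabla F$ is the gradient with respect to the inner product of $H$. ''Integrable'' means $\int_0^\infty |g(t)|\,\mathrm{d}t<\infty$. The function $F$ does not depend on $g$. *)

(* Defs.v *)
From HB Require Import structures.
From mathcomp Require Import all_boot all_order all_algebra.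
From mathcomp Require Import all_classical all_reals all_analysis.

Set Implicit Arguments.
Unset Strict Implicit.
Unset Printing Implicit Defensive.

Import Order.TTheory GRing.Theory Num.Theory.
Import numFieldNormedType.Exports.

Local Open Scope classical_set_scope.
Local Open Scope ring_scope.

Definition infinite_dimensional (R : realType) (V : lmodType R) : Prop :=
  ~ exists (n : nat) (e : 'I_n -> V),
      forall x : V, exists c : 'I_n -> R, x = \sum_(i < n) c i *: e i.

Definition separable_space (T : topologicalType) : Prop :=
  exists2 D : set T, countable D & dense D.

(* Homogeneous of degree 2: no affine part, and the customary factor 1/2 is
   absorbed in B. *)
Definition quadratic (R : realType) (V : lmodType R) (F : V -> R) : Prop :=
  exists B : {symmetric V}, forall x : V, F x = B x x.

(* The differential is continuous for the operator norm on the dual of V. *)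
Definition continuously_differentiable (R : realType) (V : normedModType R)
    (F : V -> R) : Prop :=
  (forall x : V, differentiable F x) /\
  (forall (x : V) (e : R), 0 < e ->
    \forall y \near x, forall h : V, `|'d F y h - 'd F x h| <= e * `|h|).

(* v is the gradient of F at x with respect to the inner product dot. *)
Definition is_gradient (R : realType) (H : normedModType R)
    (dot : {dot H for idfun}) (F : H -> R) (x v : H) : Prop :=
  differentiable F x /\ forall h : H, 'd F x h = dot v h.

(* Derivative at t of the restriction of u to D; it is one-sided when t is an
   endpoint of D, and the values of u outside D play no role when t is in D. *)
Definition is_derive_within (R : realType) (V : normedModType R)
    (D : set R) (u : R -> V) (t : R) (v : V) : Prop :=
  (s - t)^-1 *: (u s - u t) @[s --> within D t^'] --> v.

(* Curves on [0, +oo[ are total functions whose values at negative times are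
   irrelevant. *)
Definition gradient_flow (R : realType) (H : normedModType R)
    (dot : {dot H for idfun}) (F : H -> R) (u : R -> H) : Prop :=
  continuously_differentiable F /\
  forall t : R, 0 <= t ->
    exists2 v : H, is_gradient dot F (u t) v &
                   is_derive_within `[0, +oo[ u t (- v).

(* Main.v *)
Require Import Defs.
From HB Require Import structures.
From mathcomp Require Import all_boot all_order all_algebra.
From mathcomp Require Import all_classical all_reals all_analysis.
From mathcomp Require Import ring lra.
From mathcomp Require Import measurable_realfun.

Set Implicit Arguments.
Unset Strict Implicit.
Unset Printing Implicit Defensive.

Import Order.TTheory GRing.Theory Num.Theory.
Import numFieldNormedType.Exports.

Local Open Scope classical_set_scope.
Local Open Scope ring_scope.

(* Let (e_k) be an orthonormal basis and F u = 1/2 sum_k 2^-k <u, e_k>^2.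
   Its gradient A is diagonal, so the flow with initial coefficients a_k has
   coefficients a_k exp(-2^-k t). For 2^k <= t <= 2^(k+1) the k-th mode
   alone has energy at least 1/2 2^-k a_k^2 exp(-4), which is
   max(g(2^k), 0) >= g(t) when a_k^2 = 2 exp(4) 2^k max(g(2^k), 0). By Cauchy
   condensation (a_k) is square summable, since g is monotone and integrable. *)

(** * Inner product algebra and the Cauchy-Schwarz inequality *)

Section InnerProduct.
Context (R : realType) (H : completeNormedModType R) (dot : {dot H for idfun}).
Hypothesis norm_dot : forall x : H, `|x| ^+ 2 = dot x x.

Lemma dotC x y : dot x y = dot y x.
Proof. by rewrite hermC expr0 mul1r. Qed.

Lemma dotDl x y z : dot (x + y) z = dot x z + dot y z.
Proof. exact: linearDl. Qed.
Lemma dotBl x y z : dot (x - y) z = dot x z - dot y z.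
Proof. exact: linearBl. Qed.
Lemma dotZl a x z : dot (a *: x) z = a * dot x z.
Proof. exact: linearZl_LR. Qed.
Lemma dotDr x y z : dot z (x + y) = dot z x + dot z y.
Proof. by rewrite !(dotC z) dotDl. Qed.
Lemma dotBr x y z : dot z (x - y) = dot z x - dot z y.
Proof. by rewrite !(dotC z) dotBl. Qed.
Lemma dotZr a x z : dot z (a *: x) = a * dot z x.
Proof. by rewrite !(dotC z) dotZl. Qed.
Lemma dot0l z : dot 0 z = 0.
Proof. by rewrite -(subrr 0) dotBl subrr. Qed.
Lemma dot_suml (I : Type) (r : seq I) (P : pred I) (f : I -> H) z :
  dot (\sum_(i <- r | P i) f i) z = \sum_(i <- r | P i) dot (f i) z.
Proof. by apply: (big_morph (dot^~ z)) => [x y|]; rewrite (dotDl, dot0l). Qed.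
Lemma dot_ge0 x : 0 <= dot x x.
Proof. by rewrite -norm_dot exprn_ge0. Qed.

Lemma dot_le_norm x y : `|dot x y| <= `|x| * `|y|.
Proof.
have [->|x0] := eqVneq x 0; first by rewrite dot0l !normr0 mul0r.
have nx : 0 < `|x| ^+ 2 by rewrite exprn_gt0 // normr_gt0.
rewrite -(@ler_pXn2r _ 2) ?nnegrE ?mulr_ge0 // exprMn real_normK ?num_real //.
(* The vector is y minus its projection onto x; its squared norm times [|x| ^+ 2] is the
   Cauchy-Schwarz defect. *)
have := dot_ge0 (y - (dot x y / `|x| ^+ 2) *: x).
rewrite !(dotBl, dotBr, dotZl, dotZr) (dotC y x) -!norm_dot.
set d := dot x y; set X := `|x| ^+ 2 in nx *.
have -> : `|y| ^+ 2 - d / X * d - (d / X * d - d / X * (d / X * X)) =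
  (X * `|y| ^+ 2 - d ^+ 2) / X by field; rewrite gt_eqF.
by rewrite pmulr_lge0 ?invr_gt0 // subr_ge0.
Qed.

Lemma cvg_dotl (T : Type) (F : set_system T) {FF : Filter F} (f : T -> H) x y :
  f t @[t --> F] --> x -> dot (f t) y @[t --> F] --> dot x y.
Proof.
move=> fx; apply/cvgrPdist_le => e e0.
(* Adding 1 keeps the divisor positive when y = 0. *)
have y0 : 0 < `|y| + 1 by rewrite ltr_wpDl.
have /cvgrPdist_le /(_ _ (divr_gt0 e0 y0)) := fx.
apply: filterS => t ft; rewrite -dotBl (le_trans (dot_le_norm _ _)) //.
apply: (le_trans (ler_wpM2r _ ft)) => //.
by rewrite -mulrA ler_piMr ?(ltW e0) // ler_pdivrMl // mulr1 lerDl.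
Qed.

(** * Fourier series along an orthonormal sequence *)

Section Orthonormal.
Variable e : nat -> H.
Hypothesis dot_e : forall i j, dot (e i) (e j) = (i == j)%:R.

Lemma dot_sume (b : nat -> R) m n k :
  dot (\sum_(m <= i < n) b i *: e i) (e k) = b k *+ (m <= k < n)%N.
Proof.
rewrite dot_suml; under eq_bigr do rewrite dotZl dot_e.
have [kmn|kmn] := boolP (m <= k < n)%N.
  rewrite (bigD1_seq k) ?iota_uniq ?mem_index_iota //= eqxx mulr1.
  by rewrite big1 ?addr0 // => i /negPf ->; rewrite mulr0.
rewrite big_seq big1 // => i; rewrite mem_index_iota.
by have [->|] := eqVneq i k; rewrite ?(negPf kmn) ?mulr0.
Qed.

Lemma norm_sume (b : nat -> R) m n :
  `|\sum_(m <= i < n) b i *: e i| ^+ 2 = \sum_(m <= i < n) b i ^+ 2.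
Proof.
rewrite norm_dot {1}dot_suml big_seq [RHS]big_seq; apply: eq_bigr => i.
by rewrite mem_index_iota => imn; rewrite dotZl dotC dot_sume imn.
Qed.

(** With s the partial Fourier sum of x, [dot s x = dot s s], so expanding the squared norm of x - s
    leaves the difference of the two sides. *)
Lemma bessel x n : \sum_(0 <= k < n) dot x (e k) ^+ 2 <= `|x| ^+ 2.
Proof.
set s := \sum_(0 <= k < n) dot x (e k) *: e k.
have ss : dot s s = \sum_(0 <= k < n) dot x (e k) ^+ 2.
  by rewrite -norm_dot norm_sume.
have sx : dot s x = dot s s.
  by rewrite ss dot_suml; apply: eq_bigr => i _; rewrite dotZl dotC.
have := dot_ge0 (x - s); rewrite !(dotBl, dotBr) (dotC x) sx ss -norm_dot.
lra.
Qed.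

(** The squared norm of a block of the vector series is the same block of the convergent series of
    squares, so the partial sums are Cauchy. Coefficients and norm pass to the limit by
    continuity. *)
Lemma riesz_fischer (b : nat -> R) C :
    (forall n, \sum_(0 <= k < n) b k ^+ 2 <= C) ->
  exists x, [/\ forall k, dot x (e k) = b k, `|x| ^+ 2 <= C &
    \sum_(0 <= k < n) b k *: e k @[n --> \oo] --> x].
Proof.
move=> bC; pose X := series (fun k => b k *: e k).
have /cvg_ex [x Xx] : cvg (X @ \oo).
  apply: cauchy_cvg; apply/cauchy_seriesP => d d0.
  have : cvg (series (fun k => b k ^+ 2) @ \oo).
    apply: nondecreasing_is_cvgn.
      by apply: nondecreasing_series => k _ _; rewrite sqr_ge0.
    by exists C => _ [n _ <-]; exact: bC.
  move=> /cvg_cauchy /cauchy_seriesP /(_ (d ^+ 2)).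
  rewrite exprn_gt0 // => /(_ isT); apply: filterS => n.
  rewrite ger0_norm ?sumr_ge0 // => [|k _]; last by rewrite sqr_ge0.
  by rewrite -norm_sume ltr_pXn2r ?nnegrE ?(ltW d0).
have Xe k : dot x (e k) = b k.
  apply: (@cvg_unique _ _ (dot (X n) (e k) @[n --> \oo])) => //.
    exact: cvg_dotl.
  (* The k-th coefficient of the partial sums is constant once n > k. *)
  apply: cvg_near_cst; near=> n; rewrite /X seriesEnat dot_sume /=.
  by have -> : (k < n)%N by near: n; exists k.+1.
exists x; split => //.
have X2 : `|X n| ^+ 2 @[n --> \oo] --> `|x| ^+ 2.
  by under eq_fun do rewrite expr2; rewrite expr2; apply: cvgM; exact: cvg_norm.
rewrite -(cvg_lim _ X2) //; apply: limr_le; first by apply/cvg_ex; exists (`|x| ^+ 2).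
by apply: nearW => n; rewrite /X seriesEnat norm_sume.
Unshelve. all: by end_near. Qed.

Section Complete.
Hypothesis e_total : forall x, (forall k, dot x (e k) = 0) -> x = 0.

Lemma fourier_inj x y : (forall k, dot x (e k) = dot y (e k)) -> x = y.
Proof.
move=> xy; apply/eqP; rewrite -subr_eq0; apply/eqP/e_total => k.
by rewrite dotBl xy subrr.
Qed.

(** By Bessel, Riesz-Fischer applies to the coefficients of x; the limit has the same coefficients
    as x, hence equals x by totality. *)
Lemma fourier_cvg x : \sum_(0 <= k < n) dot x (e k) *: e k @[n --> \oo] --> x.
Proof.
have [y [yE _ yX]] := riesz_fischer (bessel x).
by rewrite (fourier_inj yE) in yX.
Qed.

(** One half of Parseval: it turns coefficientwise estimates into norm estimates. *)
Lemma norm_le_fourier x C :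
  (forall n, \sum_(0 <= k < n) dot x (e k) ^+ 2 <= C) -> `|x| ^+ 2 <= C.
Proof. by move=> /riesz_fischer [y [/fourier_inj <-]]. Qed.

(** * Diagonal operators, known only through their action on coefficients *)

Section Diagonal.
Variables (l : nat -> R) (A : H -> H).
Hypothesis A_e : forall x k, dot (A x) (e k) = l k * dot x (e k).

Lemma diag_linear : linear A.
Proof.
move=> a x y; apply: fourier_inj => k.
by rewrite !(dotDl, dotZl, A_e); ring.
Qed.

(** Expand y in the basis and pair the partial sums with [A x]. *)
Lemma cvg_dot_diag x y :
  \sum_(0 <= k < n) l k * (dot x (e k) * dot y (e k)) @[n --> \oo] --> dot (A x) y.
Proof.
rewrite dotC (_ : (fun n => _) =
  fun n => dot (\sum_(0 <= k < n) dot y (e k) *: e k) (A x)).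
  by apply: cvg_dotl; exact: fourier_cvg.
apply/funext => n.
rewrite dot_suml; apply: eq_bigr => k _.
by rewrite dotZl (dotC (e k)) A_e; ring.
Qed.

Lemma diag_sym x y : dot (A x) y = dot x (A y).
Proof.
rewrite (dotC x); apply: cvg_unique (@cvg_dot_diag x y) _ => //.
have := @cvg_dot_diag y x; under eq_fun do
  under eq_bigr do rewrite [X in _ * X]mulrC.
exact.
Qed.

(** A series with nonnegative terms dominates each of them. This gives both the energy bound by a
    single mode and the definiteness of the form. *)
Lemma diag_ge_term x k : (forall k, 0 <= l k) -> l k * dot x (e k) ^+ 2 <= dot (A x) x.
Proof.
move=> l0; have c := @cvg_dot_diag x x; rewrite -(cvg_lim _ c) //.
apply: limr_ge; first by apply/cvg_ex; exists (dot (A x) x).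
exists k.+1 => // n /= kn; rewrite (bigD1_seq k) ?iota_uniq ?mem_index_iota //=.
rewrite lerDl sumr_ge0 // => i _.
by rewrite mulr_ge0 // -expr2 sqr_ge0.
Qed.

Lemma diag_norm x : (forall k, `|l k| <= 1) -> `|A x| <= `|x|.
Proof.
move=> l1; rewrite -(@ler_pXn2r _ 2) ?nnegrE //.
apply: norm_le_fourier => n; apply: le_trans (bessel x n).
apply: ler_sum => k _; rewrite A_e exprMn ler_piMl ?sqr_ge0 //.
by rewrite -real_normK ?num_real // exprn_ile1.
Qed.

End Diagonal.

Lemma diag_exists (l : nat -> R) : (forall k, `|l k| <= 1) ->
  exists A : H -> H, forall x k, dot (A x) (e k) = l k * dot x (e k).
Proof.
move=> l1; suff /choice [A AE] : forall x, exists y,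
  forall k, dot y (e k) = l k * dot x (e k) by exists A.
move=> x; have [n|y [yE _ _]] := @riesz_fischer (fun k => l k * dot x (e k)) (`|x| ^+ 2).
  apply: le_trans (bessel x n); apply: ler_sum => k _; rewrite exprMn.
  by rewrite ler_piMl ?sqr_ge0 // -real_normK ?num_real // exprn_ile1.
by exists y.
Qed.

End Complete.
End Orthonormal.

(** * Calculus of the quadratic form of a positive symmetric contraction *)

Section QuadraticForm.
Variable S : H -> H.
Hypothesis S_linear : linear S.
Hypothesis S_sym : forall x y, dot (S x) y = dot x (S y).
Hypothesis S_norm : forall x, `|S x| <= `|x|.
Hypothesis S_ge0 : forall x, 0 <= dot (S x) x.

(** The factor 1/2 makes the gradient exactly [S]. *)
Definition half_form x := dot (S x) x / 2.
Local Notation F := half_form.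

Let S_add x y : S (x + y) = S x + S y.
Proof. by rewrite -{1}(scale1r x) S_linear scale1r. Qed.
Let S0 : S 0 = 0.
Proof. by apply/eqP; rewrite -normr_le0; have := S_norm 0; rewrite normr0. Qed.
Let S_scale a x : S (a *: x) = a *: S x.
Proof. by rewrite -{1}(addr0 (a *: x)) S_linear S0 addr0. Qed.

Lemma quadratic_half_form : quadratic F.
Proof.
pose B x y := dot (S x) y / 2.
have Bl u : linear_for *%R (B^~ u).
  by move=> a x y; rewrite /B S_linear dotDl dotZl; ring.
have Br u : linear_for (idfun \; *%R) (B u).
  by move=> a x y; rewrite /B dotDr dotZr /=; ring.
pose Bm := bilinear_isBilinear.Build R H H R *%R (idfun \; *%R) B (conj Bl Br).
(* [false] is the exponent of the sign -1: symmetric rather than skew-symmetric. *)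
have Bs x y : B x y = (-1) ^+ false * idfun (B y x).
  by rewrite expr0 mul1r /B S_sym dotC.
pose Bh := isHermitianSesquilinear.Build R H false idfun B Bs.
pose BB : {symmetric H} := HB.pack B Bm Bh.
by exists BB.
Qed.

Lemma half_formD x h : F (h + x) = F x + dot (S x) h + F h.
Proof.
rewrite /half_form S_add !dotDl !dotDr (S_sym h x) (dotC h).
by field.
Qed.

Lemma half_form_convex_comb (p : R) x y : 0 <= p <= 1 ->
  F (p *: x + (1 - p) *: y) <= p * F x + (1 - p) * F y.
Proof.
move=> /andP[p0 p1]; have q0 : 0 <= 1 - p by rewrite subr_ge0.
(* The convexity gap is exactly p (1 - p) F (x - y). *)
have := mulr_ge0 (mulr_ge0 p0 q0) (S_ge0 (x - y)).
rewrite -subr_ge0 /half_form S_linear S_scale.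
have -> : S (x - y) = S x - S y by rewrite -scaleN1r S_add S_scale scaleN1r.
rewrite !(dotBl, dotBr, dotDl, dotDr, dotZl, dotZr) (S_sym y x) (dotC y).
lra.
Qed.

Lemma convex_half_form : convex_function [set: convex_lmodType H] F.
Proof.
by move=> t x y _ _; apply: half_form_convex_comb; apply/andP; split.
Qed.

Lemma half_form_littleo : F =o_ (0 : H) id.
Proof.
apply/eqoP => _ /posnumP[d]; near=> x.
rewrite /half_form normrM (@ger0_norm _ 2^-1) // ler_pdivrMr //.
apply: le_trans (dot_le_norm _ _) _.
apply: (@le_trans _ _ (d%:num * `|x|)); last first.
  by rewrite ler_peMr ?mulr_ge0 // ler1n.
apply: ler_wpM2r => //; apply: le_trans (S_norm _) _.
near: x; apply/nbhs_ballP; exists d%:num => //= x.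
by rewrite -ball_normE /= sub0r normrN => /ltW.
Unshelve. all: by end_near. Qed.

(** The expansion [half_formD] has a continuous linear term and the remainder F h, which is o(h)
    because |F h| is at most half of |h|^2; uniqueness of the differential concludes. *)
Lemma half_form_diff x :
  differentiable F x /\ 'd F x = dot (S x) :> (H -> R).
Proof.
have dl : linear (dot (S x) : H -> R^o).
  by move=> a y z; rewrite dotDr dotZr.
pose dL : {linear H -> R^o} := HB.pack (dot (S x) : H -> R^o)
  (GRing.isLinear.Build R H R^o _ _ dl).
have dc : continuous dL.
  have -> : (dL : H -> R^o) = fun h => dot h (S x).
    by apply/funext => h; exact: dotC.
  by move=> h; apply: cvg_dotl; exact: cvg_id.
have dF : F \o shift x = cst (F x) + dL +o_ (0 : H) id.
  apply/eqaddoE; rewrite funeqE => h /=; rewrite half_formD.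
  by congr (_ + _); rewrite -[LHS]/(F h) half_form_littleo.
have dE : 'd F x = dL :> (H -> R) by exact: diff_unique.
by split => //; apply/diff_locallyP; rewrite dE.
Qed.

Lemma half_form_gradient x : is_gradient dot F x (S x).
Proof. by have [? dE] := half_form_diff x; split => // h; rewrite dE. Qed.

Lemma continuous_half_form : continuous F.
Proof. by move=> x; apply: differentiable_continuous; have [] := half_form_diff x. Qed.

(** The differentials at y and x differ by pairing with S (y - x), of norm at most |y - x|, so the
    differential is 1-Lipschitz. *)
Lemma half_form_C1 : continuously_differentiable F.
Proof.
split=> [x|x d d0]; first by have [] := half_form_diff x.
near=> y => h; have [_ ->] := half_form_diff y; have [_ ->] := half_form_diff x.
rewrite -dotBl; apply: le_trans (dot_le_norm _ _) _; apply: ler_wpM2r => //.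
have <- : S (y - x) = S y - S x by rewrite -scaleN1r S_add S_scale scaleN1r.
apply: le_trans (S_norm _) _; near: y; apply/nbhs_ballP; exists d => //= y.
by rewrite -ball_normE /= distrC => /ltW.
Unshelve. all: by end_near. Qed.

End QuadraticForm.
End InnerProduct.

(** * Existence of an orthonormal basis indexed by the naturals *)

Section OrthonormalBasis.
Context (R : realType) (H : completeNormedModType R) (dot : {dot H for idfun}).
Hypothesis norm_dot : forall x : H, `|x| ^+ 2 = dot x x.

Definition orthonormal_set (S : set H) :=
  forall x y, S x -> S y -> dot x y = (x == y)%:R.

(** Zorn's lemma: a nonzero vector orthogonal to a maximal set could be normalised and adjoined. In
    a union of a chain, any two elements already lie in one member. *)
Lemma exists_maximal_orthonormal_set : exists S, orthonormal_set S /\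
  forall x, (forall y, S y -> dot x y = 0) -> x = 0.
Proof.
have [F FS Ftot|S [oS maxS]] := @Zorn_bigcup H orthonormal_set.
  move=> x y [A FA Ax] [B FB By]; have [AB|BA] := Ftot A B FA FB.
    exact: FS FB _ _ (AB _ Ax) By.
  exact: FS FA _ _ Ax (BA _ By).
exists S; split=> // x xS; apply: contrapT => /eqP x0.
have vv : dot (`|x|^-1 *: x) (`|x|^-1 *: x) = 1.
  rewrite !(dotZl, dotZr) -norm_dot; field.
  by rewrite normr_eq0.
have vS y : S y -> dot (`|x|^-1 *: x) y = 0 by move=> /xS xy; rewrite dotZl xy mulr0.
move: (`|x|^-1 *: x) vv vS => v vv vS.
have nSv : ~ S v by move=> /vS; rewrite vv => /eqP; rewrite oner_eq0.
apply: (maxS (S `|` [set v])).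
  by split=> [|/(_ v (or_intror erefl))//]; exact: subsetUl.
have nvS y : S y -> (v == y) = false.
  by move=> Sy; apply/negP => /eqP vy; apply: nSv; rewrite vy.
move=> y z [Sy|->] [Sz|->]; first exact: oS.
- by rewrite dotC vS // eq_sym nvS.
- by rewrite vS // nvS.
- by rewrite vv eqxx.
Qed.

(* Distinct elements are at distance sqrt 2, so points of the dense set within
   1/2 of them are distinct. *)
Lemma orthonormal_set_countable S :
  separable_space H -> orthonormal_set S -> countable S.
Proof.
move=> [D /countable_injP[f finj] Ddense] oS; apply/countable_injP.
have /choice[d dE] : forall x : H, exists y, D y /\ `|x - y| < 2^-1.
  move=> x; have [||y [xy Dy]] := Ddense (ball x 2^-1).
  - by exists x; exact: ballxx.
  - exact: ball_open.
  - by exists y; split => //; rewrite -ball_normE in xy.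
exists (f \o d) => x y; rewrite !inE => Sx Sy /= fxy.
have dxy : d x = d y by apply: finj fxy; rewrite inE; apply: (dE _).1.
apply/eqP; apply: contrapT => /negP/negPf xy.
have n2 : `|x - y| ^+ 2 = 2.
  rewrite norm_dot !(dotBl, dotBr) !oS // !eqxx (eq_sym y x) xy.
  by rewrite subr0 sub0r opprK -natrD.
have : `|x - y| < 1.
  have -> : x - y = (x - d x) - (y - d y) by rewrite dxy opprB addrA subrK.
  apply: le_lt_trans (ler_normB _ _) _.
  by have := (dE x).2; have := (dE y).2; lra.
move=> lt1; have : `|x - y| ^+ 2 <= 1 by rewrite exprn_ile1 // ltW.
by rewrite n2 leNgt ltr1n.
Qed.

(** If S were finite, x minus its finite Fourier sum would be orthogonal to S, hence zero, and S
    would span. *)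
Lemma orthonormal_set_infinite S : infinite_dimensional H -> orthonormal_set S ->
  (forall x, (forall y, S y -> dot x y = 0) -> x = 0) -> infinite_set S.
Proof.
move=> Hinf oS totS /finite_seqP[s0 Ss0]; apply: Hinf.
(* Without duplicates, each basis vector enters the sum once. *)
pose s := undup s0; have sS y : (y \in s) = (y \in S).
  by rewrite mem_undup Ss0 mem_setE.
exists (size s), (fun i => s`_i) => x; exists (fun i => dot x s`_i).
apply/eqP; rewrite -subr_eq0; apply/eqP/totS => z Sz.
rewrite dotBl dot_suml -(big_mkord xpredT (fun i => dot (dot x s`_i *: s`_i) z)).
rewrite -(big_nth 0 xpredT (fun y => dot (dot x y *: y) z)).
have zs : z \in s by rewrite sS inE.
rewrite (bigD1_seq z) ?undup_uniq //= big_seq_cond big1.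
  by rewrite dotZl oS // eqxx mulr1 addr0 subrr.
move=> y /andP[]; rewrite sS inE => Sy /negPf yz.
by rewrite dotZl oS // yz mulr0.
Qed.

Lemma exists_orthonormal_basis : infinite_dimensional H -> separable_space H ->
  exists e : nat -> H, (forall i j, dot (e i) (e j) = (i == j)%:R) /\
    forall x, (forall k, dot x (e k) = 0) -> x = 0.
Proof.
move=> Hinf Hsep; have [S [oS totS]] := exists_maximal_orthonormal_set.
have /card_esym/card_set_bijP[e [eS einj esurj]] :=
  eq_card_nat (orthonormal_set_countable Hsep oS) (orthonormal_set_infinite Hinf oS totS).
exists e; split=> [i j|x xe]; last by apply: totS => y /esurj[k _ <-].
rewrite oS; [|exact: eS..].
congr (nat_of_bool _)%:R; apply/eqP/eqP => [/einj->//|->//]; exact: in_setT.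
Qed.

End OrthonormalBasis.

(** * Cauchy condensation for a monotone integrable function *)

(* On [2^k / 2, 2^k[ one has |g| >= max(g(2^k), 0), and these intervals are
   disjoint. *)
Lemma condensation (R : realType) (g : R -> R) :
  {in `[0, +oo[ &, nonincreasing_fun g} ->
  lebesgue_measure.-integrable `[0, +oo[ (EFin \o g) ->
  exists C, forall n, \sum_(0 <= k < n) 2 ^+ k * Num.max (g (2 ^+ k)) 0 <= C.
Proof.
move=> gdec /integrableP[mg Ig].
pose c k := Num.max (g (2 ^+ k)) 0.
pose f (x : measurableTypeR R) := `|(g x)%:E|%E.
have f0 x : (0 <= f x)%E by exact: abse_ge0.
have mf : measurable_fun `[(0 : R), +oo[ f by exact: measurableT_comp.
have p2 k : 0 < 2 ^+ k / 2 :> R by rewrite divr_gt0 // exprn_gt0.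
have J0 (a b : R) : 0 <= a -> `[a, b[ `<=` `[0, +oo[.
  by move=> a0 x /=; rewrite !in_itv /= andbT => /andP[/(le_trans a0)].
have mJ (a b : R) : 0 <= a -> measurable_fun `[a, b[ f.
  by move=> a0; apply: measurable_funS mf => //; exact: J0.
have cJ k x : x \in `[2 ^+ k / 2, 2 ^+ k.+1 / 2[ -> ((c k)%:E <= f x)%E.
  rewrite in_itv /= exprS mulrAC mulfV ?pnatr_eq0 // mul1r => /andP[kx xk].
  rewrite lee_fin ge_max normr_ge0 andbT; apply: le_trans (ler_norm _).
  apply: gdec; last exact: ltW.
    by rewrite in_itv /= andbT (le_trans (ltW (p2 k))).
  by rewrite in_itv /= andbT exprn_ge0.
pose I (a b : R) := (\int[lebesgue_measure]_(x in `[a, b[) f x)%E.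
(* Induction adds one dyadic block, of length [2 ^+ n / 2]. Its right end 2^n is written
   [2 ^+ n.+1 / 2] so that it matches the left end of the next block. *)
have main n : ((\sum_(0 <= k < n) 2 ^+ k / 2 * c k)%:E <= (I 2^-1 (2 ^+ n / 2))%R)%E.
  elim: n => [|n IHn]; first by rewrite big_nil integral_ge0.
  rewrite big_nat_recr //= EFinD /I.
  have h1 : (BLeft (2^-1 : R) <= BLeft (2 ^+ n / 2))%O.
    by rewrite bnd_simp ler_peMl ?invr_ge0 // exprn_ege1 ?ler1n.
  have h2 : (BLeft (2 ^+ n / 2 : R) <= BLeft (2 ^+ n.+1 / 2))%O.
    by rewrite bnd_simp exprS ler_pM2r ?invr_gt0 // ler_peMl ?exprn_ge0 ?ler1n.
  rewrite (itv_bndbnd_setU h1 h2) ge0_integral_setU //=; first last.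
  - apply/disj_setPS => x [] /=; rewrite !in_itv /= => /andP[_ xn] /andP[nx _].
    by move: (lt_le_trans xn nx); rewrite ltxx.
  - by rewrite -(itv_bndbnd_setU h1 h2); apply: mJ; rewrite invr_ge0.
  pose m := (\int[lebesgue_measure]_(x in `[(2 ^+ n / 2)%R, (2 ^+ n.+1 / 2)%R[)
    cst (c n)%:E x)%E.
  apply: leeD => //; apply: (@le_trans _ _ m).
    rewrite /m integral_cst //= lebesgue_measure_itv /= lte_fin.
    rewrite ifT -?EFinD -?EFinM ?lee_fin.
      by rewrite exprS mulrC; lra.
    by rewrite ltr_pM2r ?invr_gt0 // exprS ltr_pMl ?exprn_gt0 // ltr1n.
  apply: ge0_le_integral => //.
  - by move=> x _; rewrite lee_fin le_max lexx orbT.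
  - exact: mJ (ltW (p2 n)).
  - by move=> x; exact: cJ.
pose I0 := (\int[lebesgue_measure]_(x in `[0%R, +oo[) f x)%E.
(* The factor 2 makes up for the block length being half of 2^k. *)
exists (2 * fine I0) => n.
rewrite -ler_pdivrMl // mulr_sumr -lee_fin fineK; last first.
  by rewrite ge0_fin_numE // integral_ge0.
under eq_bigr do rewrite mulrA (mulrC 2^-1).
apply: le_trans (main n) _; apply: ge0_subset_integral => //.
exact: J0.
Qed.

(** * Scalar estimates for the exponential, and dyadic intervals *)

(** The remainder is nonnegative as exp y >= 1 + y. From exp (-y) >= 1 - y comes exp y <= 1 / (1 -
    y), so it is at most y^2 / (1 - y) <= 2 y^2. *)
Lemma expR_taylor1_le (R : realType) (y : R) :
  `|y| <= 2^-1 -> `|expR y - 1 - y| <= 2 * y ^+ 2.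
Proof.
rewrite ler_norml => /andP[y1 y2].
have := expR_ge1Dx y; have := expR_ge1Dx (- y); rewrite expRN.
have := expR_gt0 y; move: (expR y) => E E0 EN Ey.
have EN' : E * (1 - y) <= 1.
  by rewrite mulrC -ler_pdivlMr // mul1r; lra.
by rewrite ger0_norm; nra.
Qed.

(** The bound is uniform in the rate l, so that it can be summed over all modes. Factor out exp (- l
    t) <= 1 and use the Taylor bound at - l (s - t). *)
Lemma diff_quot_expR_le (R : realType) (l s t : R) :
  0 <= l <= 1 -> 0 <= t -> s != t -> `|s - t| <= 2^-1 ->
  `|(s - t)^-1 * (expR (- (l * s)) - expR (- (l * t))) + l * expR (- (l * t))|
    <= 2 * `|s - t|.
Proof.
move=> /andP[l0 l1] t0 st; have d0 : s - t != 0 by rewrite subr_eq0.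
have -> : - (l * s) = - (l * t) + - (l * (s - t)) by ring.
rewrite expRD; move: (s - t) d0 => d d0 dle.
have -> : d^-1 * (expR (- (l * t)) * expR (- (l * d)) - expR (- (l * t))) +
    l * expR (- (l * t)) =
  expR (- (l * t)) * ((expR (- (l * d)) - 1 - - (l * d)) / d) by field.
rewrite normrM ger0_norm ?expR_ge0 //.
apply: (@le_trans _ _ (1 * (2 * `|d|))); last by rewrite mul1r.
apply: ler_pM => //.
  by rewrite expR_le1 oppr_le0 mulr_ge0.
rewrite normrM normfV ler_pdivrMr ?normr_gt0 //.
apply: le_trans (expR_taylor1_le _) _.
  rewrite normrN normrM (ger0_norm l0); apply: le_trans dle.
  by rewrite ler_piMl.
rewrite sqrrN exprMn -[leRHS]mulrA -normrM -expr2 (ger0_norm (sqr_ge0 d)).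
by rewrite ler_pM2l // ler_piMl ?sqr_ge0 // exprn_ile1.
Qed.

Lemma exists_dyadic_itv (R : realType) (t : R) :
  1 <= t -> exists k, 2 ^+ k <= t <= 2 ^+ k.+1.
Proof.
move=> t1; have t0 : 0 <= t by exact: le_trans t1.
have /andP[nt tn] := truncn_itv t0; set n := Num.trunc t in nt tn.
have n0 : (0 < n)%N by rewrite truncn_gt0.
have /andP[kn nk] := @trunc_log_bounds 2 n isT n0.
(* With n the integer part of t, n < 2^(k+1) gives n + 1 <= 2^(k+1), which bounds t. *)
exists (trunc_log 2 n); rewrite -!natrX (le_trans _ nt) ?ler_nat //=.
by rewrite (le_trans (ltW tn)) // ler_nat.
Qed.

(** * The flow of a diagonal operator, built mode by mode *)

Section DiagonalFlow.
Context (R : realType) (H : completeNormedModType R) (dot : {dot H for idfun}).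
Hypothesis norm_dot : forall x : H, `|x| ^+ 2 = dot x x.
Variable e : nat -> H.
Hypothesis dot_e : forall i j, dot (e i) (e j) = (i == j)%:R.
Hypothesis e_total : forall x, (forall k, dot x (e k) = 0) -> x = 0.
Variables (l : nat -> R) (A : H -> H).
Hypothesis l01 : forall k, 0 <= l k <= 1.
Hypothesis A_e : forall x k, dot (A x) (e k) = l k * dot x (e k).

(* The absolute value keeps the coefficients square summable at negative
   times. *)
Lemma diag_flow_exists (a : nat -> R) (C : R) :
    (forall n, \sum_(0 <= k < n) a k ^+ 2 <= C) ->
  exists u : R -> H, forall t k, dot (u t) (e k) = a k * expR (- (l k * `|t|)).
Proof.
move=> aC; suff /choice[u uE] : forall t : R, exists x : H,
  forall k, dot x (e k) = a k * expR (- (l k * `|t|)) by exists u.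
move=> t; have [n|x [xE _ _]] := @riesz_fischer R H dot norm_dot e dot_e
    (fun k => a k * expR (- (l k * `|t|))) C; last by exists x.
apply: le_trans (aC n); apply: ler_sum => k _.
have /andP[l0 _] := l01 k.
rewrite exprMn ler_piMr ?sqr_ge0 // exprn_ile1 ?expR_ge0 //.
by rewrite expR_le1 oppr_le0 mulr_ge0.
Qed.

(** The k-th coefficient of the difference quotient error is at most 2 |s - t| |a k|; summing
    squares bounds its norm by 2 |s - t| sqrt C. *)
Lemma diag_flow_derive (a : nat -> R) (C : R) (u : R -> H) (t : R) :
    (forall n, \sum_(0 <= k < n) a k ^+ 2 <= C) ->
    (forall t k, dot (u t) (e k) = a k * expR (- (l k * `|t|))) ->
  0 <= t -> is_derive_within `[0, +oo[ u t (- A (u t)).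
Proof.
move=> aC uE t0; apply/cvgrPdist_le => d d0.
pose M := Num.sqrt C + 1; have M0 : 0 < M by rewrite ltr_wpDl ?sqrtr_ge0.
have C0 : 0 <= C by have := aC 0; rewrite big_nil.
(* 1/2 is the range of the Taylor bound; the other term gives 2 |s - t| M <= d. *)
pose r := Num.min 2^-1 (d / (2 * M)).
have r0 : 0 < r by rewrite lt_min invr_gt0 ltr0n divr_gt0 // mulr_gt0.
rewrite near_withinE near_withinE; apply/nbhs_ballP; exists r => //= s.
rewrite -ball_normE /= distrC lt_min => /andP[sh sd] st.
rewrite in_itv /= andbT => s0.
rewrite -normrN opprB opprK.
apply: (@le_trans _ _ (2 * `|s - t| * M)); last first.
  by rewrite mulrAC mulrC -ler_pdivlMr ?mulr_gt0 // ltW.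
rewrite -(@ler_pXn2r _ 2) ?nnegrE ?mulr_ge0 ?(ltW M0) // exprMn.
apply: (@le_trans _ _ ((2 * `|s - t|) ^+ 2 * C)); last first.
  rewrite ler_wpM2l ?sqr_ge0 // -{1}(sqr_sqrtr C0).
  rewrite ler_pXn2r ?nnegrE ?sqrtr_ge0 ?(ltW M0) //.
  by rewrite lerDl.
apply: (norm_le_fourier norm_dot dot_e e_total) => n.
apply: (@le_trans _ _ (\sum_(0 <= k < n) (2 * `|s - t|) ^+ 2 * a k ^+ 2)); last first.
  by rewrite -mulr_sumr ler_wpM2l ?sqr_ge0.
apply: ler_sum => k _.
rewrite !(dotBl, dotDl, dotZl) A_e !uE (ger0_norm s0) (ger0_norm t0).
have -> : (s - t)^-1 * (a k * expR (- (l k * s)) - a k * expR (- (l k * t))) +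
    l k * (a k * expR (- (l k * t))) =
  ((s - t)^-1 * (expR (- (l k * s)) - expR (- (l k * t))) +
    l k * expR (- (l k * t))) * a k by ring.
rewrite exprMn ler_wpM2r ?sqr_ge0 // -real_normK ?num_real //.
rewrite ler_pXn2r ?nnegrE ?mulr_ge0 //.
by apply: diff_quot_expR_le => //; exact: ltW.
Qed.

End DiagonalFlow.

(** * Choice of the function, then of the initial data for a given g *)

Theorem lemma2p6 (R : realType) (H : completeNormedModType R)
    (dot : {dot H for idfun})
    (norm_dot : forall x : H, `|x| ^+ 2 = dot x x)
    (H_infdim : infinite_dimensional H)
    (H_separable : separable_space H) :
  exists F : H -> R,
    [/\ continuous F,
        quadratic F,
        convex_function [set: convex_lmodType H] F,
        forall u : H, F u = 0 <-> u = 0 &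
        forall g : R -> R,
          {in `[0, +oo[ &, nonincreasing_fun g} ->
          lebesgue_measure.-integrable `[0, +oo[ (EFin \o g) ->
          exists2 u : R -> H, gradient_flow dot F u &
            forall t : R, 1 <= t -> g t <= F (u t)].
Proof.
have [e [dot_e e_total]] := exists_orthonormal_basis norm_dot H_infdim H_separable.
pose l k : R := (2 ^+ k)^-1.
have l_gt0 k : 0 < l k by rewrite invr_gt0 exprn_gt0.
have l01 k : 0 <= l k <= 1.
  by rewrite ltW //= invf_le1 ?exprn_gt0 // exprn_ege1 // ler1n.
have l_norm k : `|l k| <= 1 by have /andP[l0 l1] := l01 k; rewrite ger0_norm.
have [A A_e] := diag_exists norm_dot dot_e l_norm.
have Alin := diag_linear e_total A_e.
have Asym := diag_sym norm_dot dot_e e_total A_e.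
have Anorm x := diag_norm norm_dot dot_e e_total A_e x l_norm.
have Aterm x k := diag_ge_term norm_dot dot_e e_total A_e x k (fun k => ltW (l_gt0 k)).
have Age0 x : 0 <= dot (A x) x.
  by apply: le_trans (Aterm x 0); rewrite mulr_ge0 ?sqr_ge0 // ltW.
exists (half_form dot A); split.
- exact: continuous_half_form.
- exact: quadratic_half_form.
- exact: convex_half_form.
- move=> x; split=> [|->]; last by rewrite /half_form dotC dot0l mul0r.
  (* Every term is at most <A x, x> = 0 while [l k] > 0, so all coefficients vanish. *)
  move=> /eqP; rewrite mulf_eq0 invr_eq0 pnatr_eq0 orbF => /eqP Ax.
  apply: e_total => k; apply/eqP; rewrite -sqrf_eq0 eq_le sqr_ge0 andbT.
  by have := Aterm x k; rewrite Ax pmulr_rle0.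
move=> g gdec /(condensation gdec)[C gC].
pose c k := Num.max (g (2 ^+ k)) 0.
have c0 k : 0 <= c k by rewrite le_max lexx orbT.
pose a k := Num.sqrt (2 * expR 4 * (2 ^+ k * c k)).
have aE k : a k ^+ 2 = 2 * expR 4 * (2 ^+ k * c k).
  by rewrite sqr_sqrtr // !mulr_ge0 ?expR_ge0 ?exprn_ge0.
have aC n : \sum_(0 <= k < n) a k ^+ 2 <= 2 * expR 4 * C.
  under eq_bigr do rewrite aE.
  by rewrite -mulr_sumr ler_wpM2l ?mulr_ge0 ?expR_ge0.
have [u uE] := diag_flow_exists norm_dot dot_e l01 aC.
exists u => [|t t1].
  split=> [|t t0]; first exact: half_form_C1.
  exists (A (u t)); first exact: half_form_gradient.
  exact: (diag_flow_derive norm_dot dot_e e_total l01 A_e aC uE).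
have [k /andP[kt tk]] := exists_dyadic_itv t1.
have t0 : 0 <= t by exact: le_trans t1.
apply: (@le_trans _ _ (c k)).
  rewrite le_max; apply/orP; left; apply: gdec => //.
  - by rewrite in_itv /= andbT exprn_ge0.
  - by rewrite in_itv /= andbT.
rewrite /half_form ler_pdivlMr //; apply: le_trans (Aterm (u t) k).
rewrite uE ger0_norm // exprMn aE -expRM_natl.
(* In a_k^2 the factor 2^k cancels [l k], the 2 offsets the half in the form, and [expR 4] absorbs
   the decay: t <= 2^(k+1) gives [l k * t] <= 2, so 4 - 2 [l k] t >= 0. *)
have -> : l k * (2 * expR 4 * (2 ^+ k * c k) * expR (2 * - (l k * t))) =
    (l k * 2 ^+ k) * (c k * 2 * (expR 4 * expR (2 * - (l k * t)))) by ring.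
rewrite mulVf ?expf_neq0 ?pnatr_eq0 // mul1r -expRD ler_peMr ?mulr_ge0 //.
rewrite -[leLHS]expR0 ler_expR.
have : l k * t <= 2 by rewrite mulrC ler_pdivrMr ?exprn_gt0 // -exprS.
lra.
Qed.
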